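(* Let $n\ge 2$. There is a constant $c_n$ depending only on $n$ such that for all finite collections $\mathfrak{L}_1,\ldots,\mathfrak{L}_n$ of $L_1,\ldots,L_n$ lines in $\mathbb{R}^n$, respectively, $$|J(\mathfrak{L}_1,\ldots,\mathfrak{L}_n)|\le c_n\,(L_1\cdots L_n)^{1/(n-1)}.$$
   Context: For finite collections $\mathfrak{L}_1,\ldots,\mathfrak{L}_n$ of lines in $\mathbb{R}^n$, a point $x\in\mathbb{R}^n$ is a multijoint formed by them if for each $i=1,\ldots,n$ there is a line $l_i\in\mathfrak{L}_i$ passing through $x$ such that the directions of $l_1,\ldots,l_n$ span $\mathbb{R}^n$. $J(\mathfrak{L}_1,\ldots,\mathfrak{L}_n)$ denotes the set of such multijoints. *)

(* Defs.v *)
From mathcomp Require Import all_boot all_order all_algebra.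
From mathcomp Require Import finmap.
From mathcomp Require Import boolp classical_sets cardinality reals exp.

Set Implicit Arguments.
Unset Strict Implicit.
Unset Printing Implicit Defensive.

Import Order.TTheory GRing.Theory Num.Theory.

Local Open Scope classical_set_scope.
Local Open Scope ring_scope.

Definition is_direction (R : realType) (n : nat) (v : 'rV[R]_n)
    (l : set 'rV[R]_n) : Prop :=
  v != 0 /\ exists p : 'rV[R]_n, l = [set p + t *: v | t in [set: R]].

Definition is_line (R : realType) (n : nat) (l : set 'rV[R]_n) : Prop :=
  exists v : 'rV[R]_n, is_direction v l.

(* A direction vector of a line is unique up to a nonzero scalar, so the
   existential on [v] could equivalently be a universal one. *)
Definition multijoint (R : realType) (n : nat)
    (LL : 'I_n -> {fset (set 'rV[R]_n)}) (x : 'rV[R]_n) : Prop :=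
  exists l : 'I_n -> set 'rV[R]_n,
    (forall i, l i \in LL i /\ l i x) /\
    exists v : 'I_n -> 'rV[R]_n,
      (forall i, is_direction (v i) (l i)) /\
      <<[seq v i | i <- enum 'I_n]>>%VS = fullv.

Definition J (R : realType) (n : nat)
    (LL : 'I_n -> {fset (set 'rV[R]_n)}) : set 'rV[R]_n :=
  [set x | multijoint LL x].

(* Main.v *)
Require Import Defs.
From HB Require Import structures.
From mathcomp Require Import all_boot all_order all_algebra.
From mathcomp Require Import finmap.
From mathcomp Require Import boolp classical_sets cardinality reals exp.
From mathcomp Require Import mpoly zify.

Set Implicit Arguments.
Unset Strict Implicit.
Unset Printing Implicit Defensive.

Import Order.TTheory GRing.Theory Num.Theory.

Local Open Scope classical_set_scope.
Local Open Scope ring_scope.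

(* Choose, at every multijoint, one line of each colour with spanning directions.
   Suppose that every chosen line of colour i carries at least s_i of the points
   that chose it. Among the polynomials with all exponents at most D/n (so of degree
   at most D), impose at each point p the vanishing of those mixed
   derivatives along the chosen directions whose order a_i in the i-th direction
   satisfies s_i a_i <= D for all i. This forces the polynomial to be 0, by induction
   on the order of vanishing r: if s_i a_i > D, take the derivatives in the other
   directions first and restrict to the i-th line; the result has degree at most D
   and vanishes to order a_i at s_i points, hence is 0. Counting conditions against
   monomials, prod s_i <= (n+1)^n * #points.
   Hence if prod s_i exceeds this bound for the whole set of points, one can remove
   lines one at a time, each removal of a line of colour i deleting fewer than s_i
   points, so that #points <= sum_i L_i (s_i - 1); take s_i proportional to 1/L_i. *)

(** * Zeros of univariate polynomials, counted with multiplicity *)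

Lemma derivn_mulXsubC (F : comNzRingType) (q : {poly F}) (t : F) (j : nat) :
  (q * ('X - t%:P))^`(j.+1) = q^`(j.+1) * ('X - t%:P) + q^`(j) *+ j.+1.
Proof.
elim: j => [|j IH].
  by rewrite !derivn1 derivM derivXsubC mulr1 derivn0 mulr1n.
rewrite [LHS]derivnS IH derivD derivM derivXsubC mulr1 derivMn -!derivnS.
by rewrite -addrA; congr (_ + _); rewrite mulrS.
Qed.

(** If [h = q * ('X - t%:P)], the derivative of order [j.+1] of [h] at [t] is [j.+1] times that of
    order [j] of [q]. In characteristic 0 the vanishing thus passes to [q], with one order less. *)
Lemma dvdp_XsubC_exp_derivn (F : numFieldType) (k : nat) (h : {poly F}) (t : F) :
  (forall j, (j < k)%N -> root h^`(j) t) -> ('X - t%:P) ^+ k %| h.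
Proof.
elim: k h => [|k IH] h H; first by rewrite expr0 dvd1p.
have /factor_theorem[q hq] : root h t by have := H 0%N isT; rewrite derivn0.
rewrite hq exprSr dvdp_mul2r ?polyXsubC_eq0 //; apply: IH => j jk.
have := H j.+1 jk; rewrite /root hq derivn_mulXsubC hornerD hornerM hornerXsubC.
by rewrite subrr mulr0 add0r hornerMn mulrn_eq0.
Qed.

Lemma dvdp_prod_XsubC_exp (F : fieldType) (k : nat) (h : {poly F}) (ts : seq F) :
  uniq ts -> (forall t, t \in ts -> ('X - t%:P) ^+ k %| h) ->
  \prod_(t <- ts) ('X - t%:P) ^+ k %| h.
Proof.
elim: ts => [|t ts IH]; first by rewrite big_nil dvd1p.
move=> /= /andP[tts uts] H; rewrite big_cons Gauss_dvdp; last first.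
  rewrite big_seq; apply: (big_ind (coprimep _)) => [|a b ha hb|s sts].
  - exact: coprimep1.
  - by rewrite coprimepMr ha hb.
  rewrite coprimep_expl // coprimep_expr // coprimep_XsubC root_XsubC.
  by apply: contraNneq tts => <-.
rewrite H ?mem_head // IH // => s sts; apply: H; by rewrite in_cons sts orbT.
Qed.

Lemma poly_many_zeros (F : numFieldType) (k : nat) (h : {poly F}) (ts : seq F) :
  uniq ts -> (forall t j, t \in ts -> (j < k)%N -> root h^`(j) t) ->
  (size h <= size ts * k)%N -> h = 0.
Proof.
move=> uts H hs; apply/eqP/negPn/negP => h0.
have /dvdp_leq : \prod_(t <- ts) ('X - t%:P) ^+ k %| h.
  apply: dvdp_prod_XsubC_exp => // t tts.
  by apply: dvdp_XsubC_exp_derivn => j; apply: H.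
move=> /(_ h0); apply/negP; rewrite -ltnNge prodrXl.
have p0 : (\prod_(t <- ts) ('X - t%:P)) ^+ k != 0 :> {poly F}.
  by apply: expf_neq0; apply: monic_neq0; apply: monic_prod_XsubC.
by rewrite -size_poly_gt0 in p0; rewrite -(prednK p0) size_exp size_prod_XsubC.
Qed.

(** * Directional derivatives and restriction to lines *)

Section DirectionalDerivatives.
Context {F : comNzRingType} {n : nat}.
Implicit Types (f g : {mpoly F[n]}) (p v w : 'rV[F]_n).

Definition dird v f : {mpoly F[n]} := \sum_i v 0 i *: f^`M(i).
Definition dirds vs f := foldr dird f vs.

Fact dird_is_linear v : linear (dird v).
Proof.
move=> c f g; rewrite /dird scaler_sumr -big_split; apply: eq_bigr => i _ /=.
by rewrite linearP scalerDr !scalerA mulrC.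
Qed.
HB.instance Definition _ v :=
  GRing.isLinear.Build F {mpoly F[n]} {mpoly F[n]} _ (dird v) (dird_is_linear v).

Fact dirds_is_linear vs : linear (dirds vs).
Proof. by move=> c f g; elim: vs => //= v vs ->; rewrite linearP. Qed.
HB.instance Definition _ vs :=
  GRing.isLinear.Build F {mpoly F[n]} {mpoly F[n]} _ (dirds vs) (dirds_is_linear vs).

Lemma dird_sum (I : finType) (c : I -> F) (w : I -> 'rV[F]_n) f :
  dird (\sum_j c j *: w j) f = \sum_j c j *: dird (w j) f.
Proof.
rewrite /dird; under [RHS]eq_bigr do rewrite scaler_sumr.
rewrite exchange_big; apply: eq_bigr => i _ /=.
by rewrite summxE scaler_suml; apply: eq_bigr => j _; rewrite mxE scalerA.
Qed.

Lemma dirdC v w f : dird v (dird w f) = dird w (dird v f).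
Proof.
rewrite /dird; under eq_bigr do rewrite (linear_sum (mderiv _)) scaler_sumr.
under [RHS]eq_bigr do rewrite (linear_sum (mderiv _)) scaler_sumr.
rewrite exchange_big; apply: eq_bigr => i _; apply: eq_bigr => j _ /=.
by rewrite !linearZ /= !scalerA mulrC mderiv_comm.
Qed.

Lemma dirds_cat vs ws f : dirds (vs ++ ws) f = dirds vs (dirds ws f).
Proof. exact: foldr_cat. Qed.

Lemma dirds_perm vs ws f : perm_eq vs ws -> dirds vs f = dirds ws f.
Proof.
have rem_head x s : x \in s -> dirds s f = dirds (x :: rem x s) f.
  elim: s => //= y s IH; rewrite in_cons.
  by case: eqVneq => [->|nxy /= /IH ->] //=; rewrite dirdC.
elim: vs ws => [|x vs IH] ws; first by rewrite perm_sym => /perm_small_eq ->.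
move=> H; have xws : x \in ws by rewrite -(perm_mem H) mem_head.
rewrite (rem_head _ _ xws) /= -(IH (rem x ws)) // -(perm_cons x).
by rewrite (permPl H) perm_to_rem.
Qed.

Lemma dird_delta i f : dird (delta_mx 0 i) f = f^`M(i).
Proof.
rewrite /dird (bigD1 i) //= big1 ?addr0 => [|j ji]; rewrite mxE eqxx ?eqxx.
  by rewrite scale1r.
by rewrite (negbTE ji) scale0r.
Qed.

(** The pullback of [f] along [t |-> p + t *: v], kept as a polynomial in [t] so that its degree and
    derivatives can be used. *)
Definition restr p v f : {poly F} :=
  mmap polyC (fun i => (p 0 i)%:P + v 0 i *: 'X) f.

Lemma restr_horner p v f t :
  (restr p v f).[t] = f.@[fun i => (p + t *: v) 0 i].
Proof.
elim/mpolyind: f => [|c m f _ _ IH]; first by rewrite /restr mmap0 horner0 meval0.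
rewrite /restr mmapD mmapZ mmapX hornerD -/(restr _ _ _) IH mevalD mevalZ mevalX.
rewrite hornerM hornerC /mmap1 horner_prod; congr (_ * _ + _).
apply: eq_bigr => i _; rewrite horner_exp hornerD hornerC hornerZ hornerX.
by rewrite !mxE mulrC.
Qed.

(** The chain rule. Both sides are linear in [f] and obey the Leibniz rule, which reduces the claim
    to constants and single variables. *)
Lemma restr_deriv p v f : (restr p v f)^`() = restr p v (dird v f).
Proof.
have restrM g h : (restr p v g)^`() = restr p v (dird v g) ->
    (restr p v h)^`() = restr p v (dird v h) ->
    (restr p v (g * h))^`() = restr p v (dird v (g * h)).
  move=> Hg Hh; have -> : dird v (g * h) = dird v g * h + g * dird v h.
    rewrite /dird mulr_suml mulr_sumr -big_split; apply: eq_bigr => i _ /=.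
    by rewrite mderivM scalerDr scalerAl scalerAr.
  by rewrite /restr rmorphD !rmorphM /= derivM -/(restr _ _ _) Hg Hh.
elim/mpolyind: f => [|c m f _ _ IH].
  by rewrite /restr linear0 mmap0 deriv0.
rewrite linearP /= /restr !mmapD !mmapZ -!/(restr _ _ _) derivD IH; congr (_ + _).
rewrite !mul_polyC derivZ; congr (_ *: _).
rewrite mpolyXE_id.
have restr1 : (restr p v 1)^`() = restr p v (dird v 1).
  rewrite /restr rmorph1 -[1]/(1%:P) derivC /dird big1 ?rmorph0 // => i _.
  by rewrite -mpolyC1 mderivC scaler0.
elim/big_ind: _ => // i _.
elim: (m i) => [|k IHk]; first by rewrite expr0.
rewrite exprS; apply: restrM => //.
rewrite /restr mmapX mmap1U derivD derivC add0r derivZ derivX.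
rewrite /dird (bigD1 i) //= big1 ?addr0 => [|j ji].
  rewrite mderivX mnm1E eqxx -[X in (X - _)%MM]add0m addmK mpolyX0 scale1r.
  by rewrite mmapZ rmorph1 mulr1 alg_polyC.
by rewrite mderivX mnm1E eq_sym (negbTE ji) scale0r scaler0.
Qed.

Lemma restr_derivn p v f k : (restr p v f)^`(k) = restr p v (dirds (nseq k v) f).
Proof. by elim: k => // k IH; rewrite derivnS IH restr_deriv. Qed.

Lemma msize_leP f d : reflect (forall m, (d <= mdeg m)%N -> f@_m = 0) (msize f <= d)%N.
Proof.
apply: (iffP idP) => [H m dm|H].
  by apply: memN_msupp_eq0; apply: msize_mdeg_ge; apply: leq_trans dm.
rewrite msizeE; apply/bigmax_leqP_seq => m; rewrite mcoeff_msupp => fm _.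
by rewrite ltnNge; apply: contra_neqN fm => /H.
Qed.

Lemma msize_dirds vs f d : (msize f <= d)%N -> (msize (dirds vs f) <= d)%N.
Proof.
elim: vs f => //= v vs IH f /IH {IH}; move: (dirds vs f) => g /msize_leP H.
apply/msize_leP => m dm; rewrite /dird linear_sum big1 // => i _ /=.
rewrite mcoeffZ mcoeff_deriv H ?mul0rn ?mulr0 // mdegD.
by rewrite (leq_trans dm) ?leq_addr.
Qed.

Lemma size_restr p v f : (size (restr p v f) <= msize f)%N.
Proof.
rewrite /restr {1}(mpolyE f) rmorph_sum /=; apply: (leq_trans (size_sum _ _ _)).
apply/bigmax_leqP_seq => m /msize_mdeg_lt mf _; apply: leq_trans mf.
rewrite mmapZ mul_polyC (leq_trans (size_scale_leq _ _)) // mmapX /mmap1 mdegE.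
apply: (big_ind2 (fun (q : {poly F}) k => (size q <= k.+1)%N)).
- by rewrite size_poly1.
- move=> q k q' k' hq hq'; apply: (leq_trans (size_polyMleq _ _)); lia.
move=> i _; have hl : (size ((p 0 i)%:P + v 0 i *: 'X)%R <= 2)%N.
  rewrite (leq_trans (size_polyD _ _)) // geq_max (leq_trans (size_polyC_leq1 _)) //=.
  by rewrite (leq_trans (size_scale_leq _ _)) // size_polyX.
elim: (m i) => [|k IH]; first by rewrite expr0 size_poly1.
by rewrite exprS (leq_trans (size_polyMleq _ _)) //; lia.
Qed.

End DirectionalDerivatives.

(** * Vanishing to high order at points on rich lines *)

Lemma mpoly_eq0_of_dirds (F : numFieldType) (n : nat) (f : {mpoly F[n]}) (p : 'rV[F]_n) :
  (forall vs, (dirds vs f).@[p 0] = 0) -> f = 0.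
Proof.
move=> H; apply/eqP/negPn/negP => f0.
pose m := mlead f.
(* Differentiating by the leading monomial leaves only a constant: any other surviving coefficient
   would belong to a monomial of larger degree. In characteristic 0 this constant is nonzero. *)
have fm : f^`M[m] = (f@_m *+ (\prod_(i < n) (m i)^_(m i)))%:MP.
  apply/mpolyP => m'; rewrite mcoeff_mderivm mcoeffC.
  have [->|m'0] := eqVneq m' 0%MM; first by rewrite addm0 mulr1.
  rewrite mulr0 mcoeff_gt_mlead ?mul0rn //.
  by rewrite lt_mdeg_ltmc // mdegD -[X in (X < _)%N]addn0 ltn_add2l lt0n mdeg_eq0.
have [vs Hvs] : exists vs, f^`M[m] = dirds vs f.
  rewrite mderivm_foldr; elim: (flatten _) => [|i s [vs IH]]; first by exists [::].
  by exists (delta_mx 0 i :: vs) => /=; rewrite IH dird_delta.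
have := H vs; rewrite -Hvs fm mevalC; apply/eqP; rewrite mulrn_eq0 mleadc_eq0.
rewrite negb_or f0 andbT -lt0n prodn_gt0 // => i; by rewrite ffact_gt0.
Qed.

Lemma dirds_spanning (F : comNzRingType) (n : nat) (f : {mpoly F[n]}) (p : 'rV[F]_n)
    (e : 'I_n -> 'rV[F]_n) (r : nat) :
  (forall v, exists c : 'I_n -> F, v = \sum_j c j *: e j) ->
  (forall u, size u = r -> (dirds (map e u) f).@[p 0] = 0) ->
  forall vs, size vs = r -> (dirds vs f).@[p 0] = 0.
Proof.
move=> he hu vs hvs.
(* Mixed words: [ws] holds arbitrary directions, [us] indices of spanning ones. By linearity in the
   direction, the last entry of [ws] is expanded and moved into [us]. *)
suff H us ws : (size ws + size us)%N = r -> (dirds (ws ++ map e us) f).@[p 0] = 0.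
  by have := H [::] vs; rewrite /= cats0 addn0; apply.
elim/last_ind: ws us => [|ws v IH] us; first exact: hu.
rewrite size_rcons addSnnS cat_rcons => Hr.
have [c ->] := he v; rewrite dirds_cat /= dird_sum !linear_sum big1 // => j _.
by rewrite !linearZ /=; have := IH (j :: us) Hr; rewrite dirds_cat /= => ->; rewrite mulr0.
Qed.

(** The induction on [r] runs over all points of [S] and all directions at once: the step at [p]
    needs derivatives at other points [q] of the line along the directions [e p], not [e q]. Lines
    enter only through their labels. *)
Lemma rich_lines_vanishing_eq0 (F : numFieldType) (n : nat) (T : finType) (K : eqType)
    (pt : T -> 'rV[F]_n) (e : T -> 'I_n -> 'rV[F]_n) (lab : T -> 'I_n -> K)
    (S : {set T}) (s : 'I_n -> nat) (D : nat) (f : {mpoly F[n]}) :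
  injective pt ->
  (forall p v, exists c : 'I_n -> F, v = \sum_j c j *: e p j) ->
  (forall p q i, lab q i = lab p i -> exists t, pt q = pt p + t *: e p i) ->
  (exists p, p \in S) ->
  (forall p i, p \in S -> (s i <= #|[set q in S | lab q i == lab p i]|)%N) ->
  (msize f <= D.+1)%N ->
  (forall p u, p \in S -> (forall i, (s i * count_mem i u <= D)%N) ->
     (dirds (map (e p) u) f).@[pt p 0] = 0) ->
  f = 0.
Proof.
move=> pt_inj e_span on_line [p0 p0S] many hf hcond.
suff H r p vs : p \in S -> size vs = r -> (dirds vs f).@[pt p 0] = 0.
  by apply: (@mpoly_eq0_of_dirds _ _ _ (pt p0)) => vs; apply: H.
elim/ltn_ind: r p vs => r IH p vs pS; move: vs.
apply: (dirds_spanning (e_span p)) => u ur.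
have [/forallP hu|] := boolP [forall i, (s i * count_mem i u <= D)%N].
  exact: hcond.
rewrite negb_forall => /existsP[i]; rewrite -ltnNge => hi.
set k := count_mem i u in hi; pose u' := filter (predC1 i) u.
have uE : perm_eq (map (e p) u) (nseq k (e p i) ++ map (e p) u').
  rewrite -map_nseq -map_cat; apply: perm_map.
  have /all_pred1P := filter_all (pred1 i) u; rewrite size_filter -/k => <-.
  by rewrite perm_sym; apply/permPl/perm_filterC.
(* The derivatives in directions other than [i] come first; the [k] derivatives along the line then
   become ordinary derivatives of [h]. *)
pose h := restr (pt p) (e p i) (dirds (map (e p) u') f).
have hder t q j : pt q = pt p + t *: e p i ->
    h^`(j).[t] = (dirds (nseq j (e p i) ++ map (e p) u') f).@[pt q 0].
  by move=> ->; rewrite restr_derivn restr_horner -dirds_cat.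
have size_u : (k + size u' = r)%N by rewrite -ur size_filter count_predC.
pose L := [set q in S | lab q i == lab p i].
have /fin_all_exists[t ht] (q : T) : exists t, q \in L -> pt q = pt p + t *: e p i.
  have [|_] := boolP (q \in L); last by exists 0.
  by rewrite inE => /andP[_ /eqP/on_line[t ht]]; exists t.
have h0 : h = 0.
  apply: (@poly_many_zeros _ k _ (map t (enum L))).
  - rewrite map_inj_in_uniq ?enum_uniq // => q q'; rewrite !mem_enum => qL q'L tqq'.
    by apply: pt_inj; rewrite (ht q) // (ht q') // tqq'.
  - move=> x j /mapP[q]; rewrite mem_enum => qL -> jk.
    (* The order here is [j + size u'] with [j < k], hence below [r]. *)
    rewrite /root (hder _ q _ (ht _ qL)) (IH (j + size u')%N) //.
    + by rewrite -size_u ltn_add2r.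
    + by move: qL; rewrite inE => /andP[].
    + by rewrite size_cat size_nseq size_map.
  (* The chain is [size h <= D.+1 <= s i * k <= #|L| * k]. *)
  rewrite size_map -cardE; apply: (leq_trans (size_restr _ _ _)).
  apply: (leq_trans (msize_dirds _ hf)); apply: (leq_trans hi).
  by rewrite leq_mul2r many ?orbT.
by rewrite (dirds_perm _ uE) -(hder 0) ?scale0r ?addr0 // h0 derivn_poly0 ?horner0 // size_poly0.
Qed.

(** * Counting conditions against monomials *)

Lemma underdetermined (F : fieldType) (A C : finType) (phi : A -> C -> F) :
  (#|C| < #|A|)%N ->
  exists x : A -> F, (exists a, x a != 0) /\ forall c, \sum_a x a * phi a c = 0.
Proof.
move=> CA; pose M : 'M[F]_(#|A|, #|C|) := \matrix_(i, j) phi (enum_val i) (enum_val j).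
have : kermx M != 0.
  rewrite kermx_eq0 /row_free; apply: contraTneq CA => rM.
  by rewrite -leqNgt -{1}rM rank_leq_col.
case/rowV0Pn => x /sub_kermxP xM x0.
exists (fun a => x 0 (enum_rank a)); split.
  apply/existsP; apply: contraR x0 => /existsPn x0; apply/eqP/rowP => j.
  by have := x0 (enum_val j); rewrite enum_valK negbK mxE => /eqP.
move=> c; transitivity ((x *m M) 0 (enum_rank c)); last by rewrite xM mxE.
rewrite mxE (reindex_onto enum_val enum_rank) => [|a _]; last exact: enum_rankK.
by apply: eq_big => [i|i _]; rewrite ?enum_valK ?eqxx // mxE enum_rankK.
Qed.

Lemma card_mul_leq (s D : nat) :
  (#|[pred j : 'I_D.+1 | s * j <= D]| * s <= D + s)%N.
Proof.
case: s => [|s]; first by rewrite muln0.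
apply: (@leq_trans ((D %/ s.+1).+1 * s.+1)); last first.
  by rewrite mulSn addnC leq_add2r leq_divM.
rewrite leq_mul2r /= -(size_iota 0 (D %/ s.+1).+1) cardE -(size_map val).
apply: uniq_leq_size => [|_ /mapP[j + ->]].
  by rewrite (map_inj_uniq val_inj) enum_uniq.
by rewrite mem_enum inE mem_iota /= add0n ltnS leq_divRL // mulnC.
Qed.

(** Directional derivatives commute, so a word of directions matters only through its
    multiplicities; this sorted form leaves finitely many conditions per point. *)
Lemma perm_count_flatten (I : finType) (u : seq I) :
  perm_eq u (flatten [seq nseq (count_mem i u) i | i <- enum I]).
Proof.
apply/allP => j _ /=; rewrite count_flatten sumnE !big_map /=.
rewrite (bigD1 j) //= count_nseq /= eqxx mul1n big1 ?addn0 // => i ij.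
by rewrite count_nseq /= (negbTE ij).
Qed.

Lemma rich_lines_bound (F : numFieldType) (n : nat) (T : finType) (K : eqType)
    (pt : T -> 'rV[F]_n) (e : T -> 'I_n -> 'rV[F]_n) (lab : T -> 'I_n -> K)
    (S : {set T}) (s : 'I_n -> nat) :
  injective pt ->
  (forall p v, exists c : 'I_n -> F, v = \sum_j c j *: e p j) ->
  (forall p q i, lab q i = lab p i -> exists t, pt q = pt p + t *: e p i) ->
  (exists p, p \in S) ->
  (forall p i, p \in S -> (s i <= #|[set q in S | lab q i == lab p i]|)%N) ->
  (\prod_i s i <= n.+1 ^ n * #|S|)%N.
Proof.
move=> pt_inj e_span on_line S0 many; rewrite leqNgt; apply/negP => lt_prod.
have s_gt0 i : (0 < s i)%N.
  rewrite lt0n; apply: contraTneq lt_prod => si.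
  by rewrite (bigD1 i) //= si mul0n.
(* [M] serves as a common upper bound of the [s i]. Exponents up to [M] give [M.+1 ^ n] monomials of
   degree at most [D = n * M]. *)
pose M := (\sum_i s i)%N; pose D := (n * M)%N.
have sM i : (s i <= M)%N by rewrite /M (bigD1 i) //= leq_addr.
pose useq (b : {ffun 'I_n -> 'I_D.+1}) := flatten [seq nseq (b i) i | i <- enum 'I_n].
pose C := finset.setX S
  [set b : {ffun 'I_n -> 'I_D.+1} | b \in family (fun i => [pred j : 'I_D.+1 | s i * j <= D]%N)].
pose mon (a : {ffun 'I_n -> 'I_M.+1}) : {mpoly F[n]} := 'X_[[multinom a i : nat | i < n]].
pose phi a (c : {c | c \in C}) :=
  (dirds (map (e (sval c).1) (useq (sval c).2)) (mon a)).@[pt (sval c).1 0].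
have cardC : (#|{: {c | c \in C}}| < #|{: {ffun 'I_n -> 'I_M.+1}}|)%N.
  rewrite card_sig card_ffun !card_ord.
  (* Multiplying by the product of the [s i] avoids division: each factor of the condition count
     becomes at most [D + s i <= n.+1 * M.+1]. *)
  rewrite -(ltn_pmul2r (_ : 0 < \prod_i s i)%N) ?prodn_gt0 //.
  have -> : #|[pred x | x \in C]| = (#|S| * \prod_i #|[pred j : 'I_D.+1 | s i * j <= D]|)%N.
    rewrite -[LHS]/#|C| finset.cardsX cardsE card_family; congr (_ * _)%N.
    by rewrite foldrE big_map big_enum.
  rewrite -mulnA -big_split /=.
  apply: (@leq_ltn_trans (#|S| * (n.+1 ^ n * M.+1 ^ n))).
    rewrite leq_mul2l; apply/orP; right.
    rewrite -expnMn -[X in (_ ^ X)%N]card_ord -prod_nat_const.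
    apply: leq_prod => i _; apply: (leq_trans (card_mul_leq _ _)).
    by rewrite mulSn mulnS addnA addnC; have := sM i; lia.
  by rewrite mulnA mulnC ltn_pmul2l ?expn_gt0 // mulnC.
have [x [[a0 xa0] hx]] := underdetermined phi cardC.
pose f := \sum_a x a *: mon a.
have f0 : f = 0.
  apply: (rich_lines_vanishing_eq0 pt_inj e_span on_line S0 many (D := D)).
    apply/msize_leP => m Dm; rewrite /f (raddf_sum (mcoeff m)) big1 // => a _ /=.
    rewrite mcoeffZ mcoeffX; case: eqP => [am|]; last by rewrite mulr0.
    move: Dm; rewrite -am mdegE ltnNge => /negP[].
    rewrite /D -[X in (X * _)%N]card_ord -sum_nat_const.
    by apply: leq_sum => i _; rewrite mnmE -ltnS.
  move=> p u pS hu.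
  (* Since [s i] is positive, every multiplicity is at most [D], so [u] corresponds to one of the
     imposed conditions. *)
  have hD i : (count_mem i u < D.+1)%N.
    by rewrite ltnS (leq_trans _ (hu i)) // leq_pmull.
  pose b := [ffun i => Ordinal (hD i)].
  have bC : (p, b) \in C.
    rewrite finset.in_setX pS inE /=; apply/familyP => i.
    by rewrite ffunE inE /= hu.
  rewrite (@dirds_perm _ _ _ (map (e p) (useq b))); last first.
    apply: perm_map; rewrite (permPl (perm_count_flatten u)).
    suff -> : useq b = flatten [seq nseq (count_mem i u) i | i <- enum 'I_n] by [].
    by congr flatten; apply: eq_map => i; rewrite ffunE.
  rewrite /f !raddf_sum -[RHS](hx (exist (fun c => c \in C) (p, b) bC)); apply: eq_bigr => a _.
  by rewrite /= linearZ mevalZ.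
have : f@_[multinom a0 i : nat | i < n] = 0 by rewrite f0 mcoeff0.
rewrite /f (raddf_sum (mcoeff _)) (bigD1 a0) //= big1 => [|a aa0]; rewrite mcoeffZ mcoeffX.
  by rewrite eqxx mulr1 addr0; apply/eqP.
case: eqP => [am|]; last by rewrite mulr0.
case/eqP: aa0; apply/ffunP => i; apply: val_inj.
by have /mnmP/(_ i) := am; rewrite !mnmE.
Qed.

(** * Removing poor lines and choosing the thresholds *)

Lemma removal_bound (n : nat) (T : finType) (K : choiceType) (lab : T -> 'I_n -> K)
    (b : 'I_n -> nat) :
  (forall S : {set T}, (exists p, p \in S) ->
     exists p i, p \in S /\ (#|[set q in S | lab q i == lab p i]%SET| <= b i)%N) ->
  forall (S : {set T}) (L : 'I_n -> {fset K}),
    (forall p i, p \in S -> lab p i \in L i) ->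
    (#|S| <= \sum_i #|` L i| * b i)%N.
Proof.
move=> poor S; have [k] := ubnP #|S|; elim: k S => // k IH S /ltnSE-Sk L SL.
have [S0|/set0Pn S0] := eqVneq S finset.set0; first by rewrite S0 cards0.
have [p [i [pS hp]]] := poor S S0.
(* The poor line is discarded with all of its at most [b i] points, and the sum on the right drops
   by exactly [b i]. *)
pose S1 := [set q in S | lab q i == lab p i]%SET.
have S1S : S1 \subset S by apply/fintype.subsetP => q; rewrite inE => /andP[].
have pS1 : p \in S1 by rewrite inE pS eqxx.
pose L' j := if j == i then (L i `\ lab p i)%fset else L j.
have ltS : (#|S :\: S1| < k)%N.
  apply: leq_trans Sk; apply/proper_card/properP; split; first exact: finset.subsetDl.
  by exists p; rewrite // finset.in_setD pS1.
have L'S q j : q \in S :\: S1 -> lab q j \in L' j.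
  rewrite !inE negb_and /L' => /andP[+ qS]; rewrite qS /= => qi.
  by case: eqP => [->|_]; rewrite ?in_fsetD1 ?qi SL.
have := IH _ ltS L' L'S.
rewrite cardsD (finset.setIidPr S1S) leq_subLR => /leq_trans; apply.
rewrite (bigD1 i) //= [X in (_ <= X)%N](bigD1 i) //= {1}/L' eqxx.
rewrite (cardfsD1 (lab p i) (L i)) SL // mulnDl mul1n -addnA leq_add // leq_add2l.
by apply: leq_sum => j ji; rewrite /L' (negbTE ji).
Qed.

Lemma root_exists (R : realType) (n : nat) (x : R) :
  (0 < n)%N -> 0 <= x -> exists2 y : R, 0 <= y & y ^+ n = x.
Proof.
move=> n0 x0; exists (x `^ (n%:R)^-1); first exact: powR_ge0.
rewrite -powR_mulrn ?powR_ge0 // -powRrM mulVf ?powRr1 //.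
by rewrite pnatr_eq0 -lt0n.
Qed.

(** Take [l ^+ n = c * T * \prod_i N i] and let [b i] be the integer part of [l / N i]. Rounding up
    makes the product of the [(b i).+1] exceed [c * T], while rounding down keeps each [N i * b i]
    at most [l]; hence [T <= n * l]. *)
Lemma optimize_thresholds (R : realType) (n c T : nat) (N : 'I_n -> nat) :
  (0 < n)%N -> (forall i, 0 < N i)%N ->
  (forall b : 'I_n -> nat, (c * T < \prod_i (b i).+1)%N -> (T <= \sum_i N i * b i)%N) ->
  (T ^ n <= n ^ n * (c * T * \prod_i N i))%N.
Proof.
move=> n0 N0 H.
have [l l0 ln] := @root_exists R n (c * T * \prod_i N i)%N%:R n0 (ler0n _ _).
have NR i : 0 < (N i)%:R :> R by rewrite ltr0n.
pose b i := Num.truncn (l / (N i)%:R).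
have lt_b i : l / (N i)%:R < (b i).+1%:R by exact: truncnS_gt.
have b_le i : (N i)%:R * (b i)%:R <= l.
  by rewrite mulrC -ler_pdivlMr // truncn_le // divr_ge0 // ltW.
have TS : T%:R <= l *+ n.
  apply: (@le_trans _ _ (\sum_i N i * b i)%N%:R).
    rewrite ler_nat; apply: H; rewrite -(ltr_nat R).
    have -> : (c * T)%N%:R = \prod_(i < n) (l / (N i)%:R) :> R.
      rewrite big_split /= prodfV prodr_const card_ord ln [in RHS]natrM natr_prod.
      by rewrite mulfK //; apply/prodf_neq0 => i _; rewrite gt_eqF.
    (* Strictness of the product needs a nonempty index set, that is, [0 < n]. *)
    rewrite natr_prod; apply: ltr_prod; first by rewrite has_predT /index_enum -enumT size_enum_ord.
    by move=> i _; rewrite lt_b divr_ge0 // ltW.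
  rewrite natr_sum -[X in _ *+ X]card_ord -sumr_const; apply: ler_sum => i _.
  by rewrite natrM.
rewrite -(ler_nat R) natrM !natrX -ln -exprMn.
by rewrite lerXn2r ?nnegrE ?mulr_ge0 // mulr_natl.
Qed.

(** * Lines, multijoints and the final bound *)

Lemma span_coord (R : fieldType) (n : nat) (V : vectType R) (v : 'I_n -> V) :
  <<[seq v i | i <- enum 'I_n]>>%VS = fullv ->
  forall w, exists c : 'I_n -> R, w = \sum_j c j *: v j.
Proof.
move=> vfull w; have := memvf w; rewrite -vfull span_def big_map big_enum.
case/memv_sumP => vs vsP ->.
have /fin_all_exists[c hc] j : exists c, vs j = c *: v j by apply/vlineP/vsP.
by exists c; apply: eq_bigr => j _.
Qed.

Lemma is_direction_sub (R : realType) (n : nat) (v x y : 'rV[R]_n) (l : set 'rV[R]_n) :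
  is_direction v l -> l x -> l y -> exists t, y = x + t *: v.
Proof.
move=> [_ [p ->]] [a _ <-] [b _ <-]; exists (b - a).
by rewrite -addrA -scalerDl [a + _]addrC subrK.
Qed.

(** Stated for finite sets of multijoints with a bound independent of [B], so that it also yields
    the finiteness of [J LL]. *)
Lemma fset_multijoint_bound (R : realType) (n : nat)
    (LL : 'I_n -> {fset (set 'rV[R]_n)}) (B : {fset 'rV[R]_n}) :
  (1 < n)%N -> [set` B] `<=` J LL ->
  (#|` B| ^ n.-1 <= n ^ n * n.+1 ^ n * \prod_i #|` LL i|)%N.
Proof.
move=> n1 BJ; have n0 := ltnW n1.
have [->|Bn0] := posnP #|` B|; first by rewrite exp0n // ltn_predRL.
have [x0 x0B] : exists x, x \in B by apply/fset0Pn; rewrite -cardfs_gt0.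
have /fin_all_exists[lab hlab] (p : B) : exists l : 'I_n -> set 'rV[R]_n,
    (forall i, l i \in LL i /\ l i (val p)) /\ exists v : 'I_n -> 'rV[R]_n,
      (forall i, is_direction (v i) (l i)) /\ <<[seq v i | i <- enum 'I_n]>>%VS = fullv.
  exact: BJ (valP p).
have /fin_all_exists[e he] (p : B) := (hlab p).2.
have N0 i : (0 < #|` LL i|)%N.
  by rewrite cardfs_gt0; apply/fset0Pn; exists (lab [` x0B]%fset i); exact: ((hlab _).1 i).1.
have : (#|` B| ^ n <= n ^ n * (n.+1 ^ n * #|` B| * \prod_i #|` LL i|))%N.
  apply: (@optimize_thresholds R) => // b hb.
  rewrite cardfE -cardsT; apply: (@removal_bound _ _ _ lab b); last first.
    by move=> p i _; exact: ((hlab p).1 i).1.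
  move=> S S0.
  have [/existsP[p /existsP[i /andP[pS pi]]]|] :=
    boolP [exists p, [exists i, (p \in S) && (#|[set q in S | lab q i == lab p i]%SET| <= b i)%N]].
    by exists p, i.
  rewrite negb_exists => /forallP many.
  (* If no chosen line through [S] were poor, thresholds [(b i).+1] would contradict [hb], because
     [#|S|] is at most the size of [B]. *)
  suff : (\prod_i (b i).+1 <= n.+1 ^ n * #|S|)%N.
    move=> /(leq_trans hb); rewrite ltn_pmul2l ?expn_gt0 // cardfE ltnNge.
    by rewrite max_card.
  apply: (@rich_lines_bound R n B _ val e lab S) => //.
  - exact: val_inj.
  - by move=> p v; apply: span_coord; case: (he p).
  - move=> p q i lab_pq; have [dir _] := he p; apply: (is_direction_sub (dir i)).
      exact: ((hlab p).1 i).2.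
    by rewrite -lab_pq; exact: ((hlab q).1 i).2.
  move=> p i pS; have := many p; rewrite negb_exists => /forallP/(_ i).
  by rewrite pS /= -ltnNge.
(* Cancelling one factor [#|B|] turns the exponent [n] into [n.-1]. *)
have -> : (#|` B| ^ n = #|` B| ^ n.-1 * #|` B|)%N by rewrite -expnSr prednK.
by rewrite [(_ * #|` B| * _)%N]mulnAC !mulnA leq_pmul2r.
Qed.

Theorem theorem2 (R : realType) (n : nat) (hn : (2 <= n)%N) :
  exists c : R, forall LL : 'I_n -> {fset (set 'rV[R]_n)},
    (forall (i : 'I_n) (l : set 'rV[R]_n), l \in LL i -> is_line l) ->
    finite_set (J LL) /\
    (#|` fset_set (J LL)|)%:R <=
      c * ((\prod_(i < n) #|` LL i|)%N%:R `^ (n.-1%:R)^-1).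
Proof.
have n1 : (0 < n.-1)%N by rewrite ltn_predRL.
exists ((n ^ n * n.+1 ^ n)%N%:R `^ (n.-1%:R)^-1) => LL _.
have finJ : finite_set (J LL).
  (* An infinite [J LL] would contain a finite [B] larger than the bound, yet [#|B| <= #|B| ^ n.-1]
     since [n.-1] is positive. *)
  apply: contrapT => /(infinite_set_fset (n ^ n * n.+1 ^ n * \prod_i #|` LL i|).+1)[B BJ] ltB.
  have := leq_ltn_trans (fset_multijoint_bound hn BJ) ltB; apply/negP; rewrite -leqNgt.
  by rewrite -[X in (X <= _)%N]expn1 leq_pexp2l // (leq_trans _ ltB).
split=> //; set N := #|` _|.
have bound : (N ^ n.-1 <= n ^ n * n.+1 ^ n * \prod_i #|` LL i|)%N.
  by apply: fset_multijoint_bound => //; rewrite fset_setK.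
rewrite -powRM ?ler0n // -natrM.
have -> : N%:R = (N ^ n.-1)%N%:R `^ (n.-1%:R)^-1 :> R.
  by rewrite natrX -powR_mulrn ?ler0n // -powRrM divff ?powRr1 // pnatr_eq0 -lt0n.
by apply: ge0_ler_powR; rewrite ?nnegrE ?ler0n ?invr_ge0 ?ler_nat.
Qed.
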